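(* Each of the following two sets of $8\times 8$ matrices is a minimal generating set for $\mathrm{O}(8,\mathbb{D})$ (it generates $\mathrm{O}(8,\mathbb{D})$ and no proper subset of it generates $\mathrm{O}(8,\mathbb{D})$): (1) $\Sigma_K=\{X_0,\ CX_{0,1},\ CCX_{1,2},\ K_{[0,1,2,3]}\}$; (2) $\Sigma_Z=\{X_0,\ CX_{0,1},\ CCX_{1,2},\ K_{1,2},\ CCZ\}$.
   Context: $\mathbb{D}=\mathbb{Z}[1/2]$ and $\mathrm{O}(8,\mathbb{D})$ is the group of $8\times8$ orthogonal matrices with entries in $\mathbb{D}$. Qubits are labelled $0,1,2$; $|x_0x_1x_2\rangle$ is identified with the standard basis vector $e_{4x_0+2x_1+x_2}$ of $\mathbb{R}^8$. $X=\begin{bmatrix}0&1\\1&0\end{bmatrix}$, $H=\frac1{\sqrt2}\begin{bmatrix}1&1\\1&-1\end{bmatrix}$. $X_0=X\otimes I\otimes I$; $CX_{0,1}$ sends $|x_0x_1x_2\rangle$ to $|x_0,x_1\oplus x_0,x_2\rangle$; $CCX_{1,2}$ sends $|x_0x_1x_2\rangle$ to $|x_0\oplus x_1x_2,x_1,x_2\rangle$; $K_{1,2}=I\otimes H\otimes H$; $CCZ$ is the diagonal matrix with $-1$ in the entry of $|111\rangle=e_7$ and $1$ elsewhere; $K_{[0,1,2,3]}$ is the matrix acting as $H\otimes H$ on $\mathrm{span}(e_0,e_1,e_2,e_3)$ and as the identity on $\mathrm{span}(e_4,\dots,e_7)$ (i.e. $K_{1,2}$ applied when qubit $0$ is in state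 $|0\rangle$). *)

(* Defs.v *)
(* Matrices over D = Z[1/2] are represented as rational
   matrices all of whose entries are dyadic rationals. *)
From HB Require Import structures.
From mathcomp Require Import all_boot all_order all_algebra.
Set Implicit Arguments. Unset Strict Implicit. Unset Printing Implicit Defensive.
Import Order.TTheory GRing.Theory Num.Theory.
Local Open Scope ring_scope.

Definition mat8 := 'M[rat]_8.

Definition dyadic (q : rat) : Prop :=
  exists (z : int) (k : nat), q = z%:~R / 2%:R ^+ k.

Definition O8D (M : mat8) : Prop :=
  (forall i j, dyadic (M i j)) /\ M *m M^T = 1%:M.

Inductive generated (S : mat8 -> Prop) : mat8 -> Prop :=
| gen_one : generated S 1%:M
| gen_base : forall M, S M -> generated S M
| gen_mul : forall M N, generated S M -> generated S N -> generated S (M *m N)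
| gen_inv : forall M, generated S M -> generated S (invmx M).

Definition generates (S : mat8 -> Prop) : Prop :=
  forall M, generated S M <-> O8D M.

Definition minimal_generating_set (S : mat8 -> Prop) : Prop :=
  generates S /\
  forall T : mat8 -> Prop, (forall M, T M -> S M) ->
    (exists M, S M /\ ~ T M) -> ~ generates T.

(* Basis index j = 4 x0 + 2 x1 + x2 ; bits of j *)
Definition bit0 (j : nat) : bool := odd (j %/ 4).
Definition bit1 (j : nat) : bool := odd (j %/ 2).
Definition bit2 (j : nat) : bool := odd j.
Definition idx (x0 x1 x2 : bool) : nat := 4 * x0 + 2 * x1 + x2.

Definition perm_mat (f : nat -> nat) : mat8 :=
  \matrix_(i < 8, j < 8) ((i : nat) == f j)%:R.

Definition X0 : mat8 :=
  perm_mat (fun j => idx (~~ bit0 j) (bit1 j) (bit2 j)).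
Definition CX01 : mat8 :=
  perm_mat (fun j => idx (bit0 j) (bit1 j (+) bit0 j) (bit2 j)).
Definition CCX12 : mat8 :=
  perm_mat (fun j => idx (bit0 j (+) (bit1 j && bit2 j)) (bit1 j) (bit2 j)).

(* entry (i,j) of H (x) H on qubits 1,2: (1/2)(-1)^(x1 y1 + x2 y2) *)
Definition HH (i j : nat) : rat :=
  (-1) ^+ ((bit1 i && bit1 j) + (bit2 i && bit2 j))%N / 2%:R.

(* K_{1,2} = I (x) H (x) H *)
Definition K12 : mat8 :=
  \matrix_(i < 8, j < 8) ((bit0 i == bit0 j)%:R * HH i j).

(* K_{[0,1,2,3]} : H (x) H on span(e_0..e_3), identity on span(e_4..e_7) *)
Definition K0123 : mat8 :=
  \matrix_(i < 8, j < 8)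
    (if ~~ bit0 i && ~~ bit0 j then HH i j
     else ((i : nat) == j)%:R).

Definition CCZ : mat8 :=
  \matrix_(i < 8, j < 8)
    (if ((i : nat) == j) then (if (i : nat) == 7%N then -1 else 1) else 0).

Definition Sigma_K (M : mat8) : Prop :=
  M = X0 \/ M = CX01 \/ M = CCX12 \/ M = K0123.
Definition Sigma_Z (M : mat8) : Prop :=
  M = X0 \/ M = CX01 \/ M = CCX12 \/ M = K12 \/ M = CCZ.

(* Main.v *)
(** Generation.  [CCX12] and [CCZ] are reflections and [K0123] is a product of
    two; conjugating them by the other generators produces in either group
    the reflections in every [e_i], every [e_i - e_j] and every vector
    [(e_a + e_b + e_c + e_d) / 2].  These suffice to reduce an orthogonal
    dyadic matrix to the identity column by column: if a unit vector is
    [v / 2^k] with [v] integral and [k > 0], then [|v|^2 = 4^k] forces the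
    number of odd entries of [v] to be a multiple of 4, and one reflection in
    [(+-e_a +- e_b +- e_c +- e_d) / 2], with suitable signs, makes four odd
    entries even.

    Minimality.  When one generator is removed, the others share an invariant
    that [O(8,D)] does not have: a fixed vector (without [X0] or [CX01]), a
    positive determinant (without [CCX12], for [Sigma_K]), or an invariant
    lattice: [Z^8] without [K0123] or [K12], the [E8] lattice [D8+] without
    [CCZ], and the lattice of integral vectors reducing mod 2 to the
    Reed-Muller code [RM(1,3)] without [CCX12] (for [Sigma_Z]). *)
Require Import Defs.
From mathcomp Require Import all_boot all_order all_algebra.
From mathcomp Require Import ring zify.
Set Implicit Arguments.
Unset Strict Implicit.
Unset Printing Implicit Defensive.
Import Order.TTheory GRing.Theory Num.Theory.
Local Open Scope ring_scope.

(** * Matrices given by closed functions, and computation with them *)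

Definition sum8 (F : nat -> rat) : rat :=
  foldr (fun k s => F k + s) 0 (iota 0 8).

(* Unlike a general matrix, [mxf n f] exposes a closed function on [nat], so
   that identities between such matrices can be decided by [vm_compute]. *)
Definition mxf (n : nat) (f : nat -> nat -> rat) : 'M[rat]_(8, n) :=
  \matrix_(i, j) f i j.
Arguments mxf : clear implicits.

Definition ev (n : nat) : 'cV[rat]_8 := mxf 1 (fun i _ => (i == n)%:R).

Definition zmx (d : rat) (s : seq (seq int)) : mat8 :=
  mxf 8 (fun i j => (nth 0 (nth [::] s i) j)%:~R / d).

Definition vecz (s : seq int) : 'cV[rat]_8 :=
  mxf 1 (fun i _ => (nth 0 s i)%:~R).

Lemma sum8E (F : nat -> rat) : \sum_(i < 8) F i = sum8 F.
Proof. by rewrite -(big_mkord xpredT F) unlock. Qed.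

Lemma all_iotaP n (P : pred nat) :
  all P (iota 0 n) -> forall i : 'I_n, P i.
Proof. by move/allP=> H i; apply: H; rewrite mem_iota add0n ltn_ord. Qed.

Lemma mxf_eq n f g :
  all (fun i => all (fun j => f i j == g i j) (iota 0 n)) (iota 0 8) ->
  mxf n f = mxf n g.
Proof.
move=> H; apply/matrixP => i j; rewrite !mxE; apply/eqP.
exact: (all_iotaP (all_iotaP H i) j).
Qed.

Lemma mulmxf n f g :
  mxf 8 f *m mxf n g = mxf n (fun i j => sum8 (fun k => f i k * g k j)).
Proof.
apply/matrixP => i j; rewrite !mxE -sum8E.
by apply: eq_bigr => k _; rewrite !mxE.
Qed.

Lemma mxfT f : (mxf 8 f)^T = mxf 8 (fun i j => f j i).
Proof. by apply/matrixP => i j; rewrite !mxE. Qed.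

Lemma mxfD n f g : mxf n f + mxf n g = mxf n (fun i j => f i j + g i j).
Proof. by apply/matrixP => i j; rewrite !mxE. Qed.

Lemma mxfN n f : - mxf n f = mxf n (fun i j => - f i j).
Proof. by apply/matrixP => i j; rewrite !mxE. Qed.

Lemma mxfZ n c f : c *: mxf n f = mxf n (fun i j => c * f i j).
Proof. by apply/matrixP => i j; rewrite !mxE. Qed.

Lemma mxf1 : 1%:M = mxf 8 (fun i j => (i == j)%:R).
Proof. by apply/matrixP => i j; rewrite !mxE. Qed.

Lemma perm_matE f : perm_mat f = mxf 8 (fun i j => (i == f j)%:R).
Proof. by []. Qed.

Lemma K12E : K12 = mxf 8 (fun i j => (bit0 i == bit0 j)%:R * HH i j).
Proof. by []. Qed.

Lemma K0123E : K0123 = mxf 8 (fun i j =>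
  if ~~ bit0 i && ~~ bit0 j then HH i j else (i == j)%:R).
Proof. by []. Qed.

Lemma CCZE : CCZ = mxf 8 (fun i j =>
  if i == j then (if i == 7%N then -1 else 1) else 0).
Proof. by []. Qed.

(** * Reflections over a field *)

Definition dot (F : fieldType) n (v w : 'cV[F]_n) : F := (v^T *m w) 0 0.

(* If [dot v v = 0] this is the identity, because [2 / 0 = 0]. *)
Definition refl (F : fieldType) n (v : 'cV[F]_n) : 'M[F]_n :=
  1%:M - (2 / dot v v) *: (v *m v^T).

Lemma dotE (F : fieldType) n (v w : 'cV[F]_n) :
  dot v w = \sum_i v i 0 * w i 0.
Proof. by rewrite /dot mxE; apply: eq_bigr => i _; rewrite mxE. Qed.

Lemma dotBl (F : fieldType) n (u v w : 'cV[F]_n) :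
  dot (u - v) w = dot u w - dot v w.
Proof. by rewrite /dot linearB /= mulmxBl !mxE. Qed.

Lemma trmxZ (F : fieldType) m n (c : F) (A : 'M[F]_(m, n)) :
  (c *: A)^T = c *: A^T.
Proof. by apply/matrixP => i j; rewrite !mxE. Qed.

Lemma dotZ (F : fieldType) n (c : F) (v : 'cV[F]_n) :
  dot (c *: v) (c *: v) = c ^+ 2 * dot v v.
Proof.
by rewrite /dot trmxZ -scalemxAl -scalemxAr scalerA mxE.
Qed.

Lemma refl_mulmx (F : fieldType) n (v w : 'cV[F]_n) :
  refl v *m w = w - (2 * dot v w / dot v v) *: v.
Proof.
rewrite mulmxBl mul1mx -scalemxAl -mulmxA [v^T *m w]mx11_scalar mul_mx_scalar.
by rewrite scalerA -/(dot v w) mulrAC.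
Qed.

(** An orthogonal [g] preserves [dot v v], so only the rank-one part of the reflection changes. This
    is how one known reflection yields others. *)
Lemma refl_conj (F : fieldType) n (g : 'M[F]_n) (v : 'cV[F]_n) :
  g^T *m g = 1%:M -> g *m refl v *m g^T = refl (g *m v).
Proof.
move=> gg; have ggT : g *m g^T = 1%:M by apply: mulmx1C.
rewrite /refl /dot trmx_mul mulmxBr mulmx1 mulmxBl ggT -scalemxAr -scalemxAl.
by rewrite !mulmxA -(mulmxA v^T) gg mulmx1.
Qed.

Lemma reflZ (F : fieldType) n (c : F) (v : 'cV[F]_n) :
  c != 0 -> refl (c *: v) = refl v.
Proof.
move=> c0; rewrite /refl dotZ trmxZ -scalemxAl -scalemxAr !scalerA.
congr (_ - _ *: _); set d := dot v v.
have [->|d0] := eqVneq d 0; first by rewrite !mulr0 invr0 !mulr0 !mul0r.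
by field; rewrite d0 c0.
Qed.

Lemma dot_ev (i : 'I_8) w : dot (ev i) w = w i 0.
Proof.
rewrite dotE (bigD1 i) //= mxE eqxx mul1r big1 ?addr0 // => j ji.
by rewrite mxE -[_ == _ :> nat]/(j == i) (negbTE ji) mul0r.
Qed.

Lemma refl_mxf f : refl (mxf 1 f) = mxf 8 (fun i j => (i == j)%:R -
  2 / sum8 (fun k => f k 0%N * f k 0%N) * (f i 0%N * f j 0%N)).
Proof.
apply/matrixP => i j; rewrite !mxE big_ord1 !mxE dotE -sum8E.
by congr (_ - 2 / _ * _); apply: eq_bigr => k _; rewrite mxE.
Qed.

Definition mxfE := (perm_matE, K12E, K0123E, CCZE, mxf1, refl_mxf, mulmxf,
  mxfT, mxfD, mxfN, mxfZ).

Ltac mxf_unfold := rewrite ?/X0 ?/CX01 ?/CCX12 ?/ev ?/zmx ?/vecz ?mxfE.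
Ltac mxf_compute := mxf_unfold; apply: mxf_eq; by vm_compute.

(** * Dyadic rationals and the group O(8,D) *)

Lemma dyadic_add x y : dyadic x -> dyadic y -> dyadic (x + y).
Proof.
move=> [a [k ->]] [b [l ->]]; exists (a * 2 ^+ l + b * 2 ^+ k), (k + l)%N.
rewrite exprD rmorphD !rmorphM !rmorphXn /=.
by field; rewrite !expf_neq0.
Qed.

Lemma dyadic_mul x y : dyadic x -> dyadic y -> dyadic (x * y).
Proof.
move=> [a [k ->]] [b [l ->]]; exists (a * b), (k + l)%N.
by rewrite exprD rmorphM /=; field; rewrite !expf_neq0.
Qed.

Lemma dyadic_int (z : int) : dyadic z%:~R.
Proof. by exists z, 0%N; rewrite expr0 divr1. Qed.

Lemma O8D_tr M : O8D M -> M^T *m M = 1%:M.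
Proof. by move=> [_ MM]; apply: mulmx1C. Qed.

Lemma O8D_inv M : O8D M -> invmx M = M^T.
Proof.
move=> [_ MM]; have [uM _] := mulmx1_unit MM.
by rewrite -[LHS]mulmx1 -MM mulmxA mulVmx // mul1mx.
Qed.

Lemma O8D_one : O8D 1%:M.
Proof.
split=> [i j|]; last by rewrite trmx1 mulmx1.
by rewrite mxE; case: (i == j); [exact: (dyadic_int 1) | exact: (dyadic_int 0)].
Qed.

Lemma O8D_mul M N : O8D M -> O8D N -> O8D (M *m N).
Proof.
move=> [dM MM] [dN NN]; split=> [i j|].
  rewrite mxE; apply: (big_ind dyadic) => [||k _].
  - exact: (dyadic_int 0).
  - exact: dyadic_add.
  - exact: dyadic_mul.
by rewrite trmx_mul mulmxA -(mulmxA M) NN mulmx1.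
Qed.

Lemma O8D_invmx M : O8D M -> O8D (invmx M).
Proof.
move=> OM; rewrite O8D_inv //; split=> [i j|].
  by rewrite mxE; case: OM.
by rewrite trmxK O8D_tr.
Qed.

Lemma generated_O8D S M :
  (forall N, S N -> O8D N) -> generated S M -> O8D M.
Proof.
move=> hS; elim=> {M} [|M /hS|M N _ OM _ ON|M _ OM] //.
- exact: O8D_one.
- exact: O8D_mul.
- exact: O8D_invmx.
Qed.

Lemma O8D_dot M v w : O8D M -> dot (M *m v) (M *m w) = dot v w.
Proof.
move=> OM; rewrite /dot trmx_mul -mulmxA (mulmxA M^T) O8D_tr //.
by rewrite mul1mx.
Qed.

(** * Reflections contained in a generated group *)

Definition in_refl (S : mat8 -> Prop) (v : 'cV[rat]_8) : Prop :=
  generated S (refl v).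

Lemma in_refl_act S g v : (forall N, S N -> O8D N) ->
  generated S g -> in_refl S v -> in_refl S (g *m v).
Proof.
move=> hS Gg Rv; have Og := generated_O8D hS Gg.
rewrite /in_refl -refl_conj ?O8D_tr // -O8D_inv //.
by apply: gen_mul; [exact: gen_mul | exact: gen_inv].
Qed.

Lemma in_reflZ S c v : c != 0 -> in_refl S v -> in_refl S (c *: v).
Proof. by move=> c0; rewrite /in_refl reflZ. Qed.

(** A reflection depends only on the line of its vector, so the image is needed only up to the
    factor [c], which absorbs the powers of 2 coming from [HH]. *)
Lemma in_refl_actZ c S g v w : (forall N, S N -> O8D N) ->
  generated S g -> in_refl S v -> c != 0 -> g *m v = c *: w -> in_refl S w.
Proof.
move=> hS Gg Rv c0 E; have -> : w = c^-1 *: (g *m v).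
  by rewrite E scalerA mulVf // scale1r.
by apply: in_reflZ; [rewrite invr_eq0 | exact: in_refl_act].
Qed.

(** All generators have entries in (1/2)Z, so being dyadic reduces to computing a denominator. *)
Lemma dyadic_half (q : rat) : denq (2 * q) == 1 -> dyadic q.
Proof.
move=> /eqP q2; exists (numq (2 * q)), 1%N.
rewrite -[q in LHS](mulKf (_ : 2 != 0)) // -[2 * q in LHS]divq_num_den q2.
by rewrite divr1 mulrC.
Qed.

Lemma O8D_mxf f :
  all (fun i => all (fun j => denq (2 * f i j) == 1) (iota 0 8)) (iota 0 8) ->
  mxf 8 f *m (mxf 8 f)^T = 1%:M -> O8D (mxf 8 f).
Proof.
move=> df ff; split=> // i j; rewrite mxE; apply: dyadic_half.
exact: (all_iotaP (all_iotaP df i) j).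
Qed.

Ltac O8D_compute :=
  rewrite ?/X0 ?/CX01 ?/CCX12 ?(perm_matE, K12E, K0123E, CCZE);
  apply: O8D_mxf; [by vm_compute | mxf_compute].

Lemma X0_O8D : O8D X0. Proof. O8D_compute. Qed.
Lemma CX01_O8D : O8D CX01. Proof. O8D_compute. Qed.
Lemma CCX12_O8D : O8D CCX12. Proof. O8D_compute. Qed.
Lemma K12_O8D : O8D K12. Proof. O8D_compute. Qed.
Lemma K0123_O8D : O8D K0123. Proof. O8D_compute. Qed.
Lemma CCZ_O8D : O8D CCZ. Proof. O8D_compute. Qed.

Lemma dot_evn n (n8 : (n < 8)%N) w : dot (ev n) w = w (Ordinal n8) 0.
Proof. exact: (dot_ev (Ordinal n8)). Qed.

Lemma in_refl_sym S m n :
  in_refl S (ev m - ev n) -> in_refl S (ev n - ev m).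
Proof.
by move=> R; rewrite -opprB -scaleN1r; apply: in_reflZ; rewrite // oppr_eq0.
Qed.

(** The reflection in e_a - e_b is the transposition (a b); conjugating (b c) by it gives (a c). *)
Lemma in_refl_diff_trans S a b c : (forall N, S N -> O8D N) ->
  (a < 8)%N -> (b < 8)%N -> a != b -> b != c -> a != c ->
  in_refl S (ev a - ev b) -> in_refl S (ev b - ev c) ->
  in_refl S (ev a - ev c).
Proof.
move=> hS a8 b8 ab bc ac Rab Rbc.
have := in_refl_act hS Rab Rbc; rewrite refl_mulmx !dotBl.
rewrite !(dot_evn a8) !(dot_evn b8) !mxE /= !eqxx [b == a]eq_sym.
rewrite (negbTE ab) (negbTE bc) (negbTE ac).
have -> : 2 * (0%:R - 0%:R - (1%:R - 0%:R)) /
  (1%:R - 0%:R - (0%:R - 1%:R)) = - 1 :> rat by [].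
by rewrite scaleN1r opprK addrC addrA subrK.
Qed.

(** [CCX12] is the transposition (3 7). Conjugation leads from it to seven pairs that form a tree on
    the eight indices, and composing along the tree gives all pairs. *)
Lemma in_refl_diff S : (forall N, S N -> O8D N) ->
  generated S X0 -> generated S CX01 -> generated S CCX12 ->
  generated S K12 ->
  forall i j, (i < 8)%N -> (j < 8)%N -> i != j -> in_refl S (ev i - ev j).
Proof.
move=> hS gX gCX gCCX gK.
have act g v w : generated S g -> in_refl S v -> g *m v = 1 *: w ->
  in_refl S w by move=> Gg Rv; apply: in_refl_actZ.
have R37 : in_refl S (ev 3 - ev 7).
  by rewrite /in_refl; have <- : CCX12 = refl (ev 3 - ev 7) by mxf_compute.
have R35 : in_refl S (ev 3 - ev 5) by apply: (act _ _ _ gCX R37); mxf_compute.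
have R71 : in_refl S (ev 7 - ev 1) by apply: (act _ _ _ gX R35); mxf_compute.
have /in_refl_sym R13 : in_refl S (ev 3 - ev 1).
  exact: (in_refl_diff_trans _ _ _ _ _ _ R37 R71).
(* The three permutation matrices preserve the parity of the index; [K12] crosses over by sending
   e_1 - e_3 to e_2 - e_3. *)
have R23 : in_refl S (ev 2 - ev 3) by apply: (act _ _ _ gK R13); mxf_compute.
have R67 : in_refl S (ev 6 - ev 7) by apply: (act _ _ _ gX R23); mxf_compute.
have R45 : in_refl S (ev 4 - ev 5) by apply: (act _ _ _ gCX R67); mxf_compute.
have R01 : in_refl S (ev 0 - ev 1) by apply: (act _ _ _ gX R45); mxf_compute.
have R73 := in_refl_sym R37; have R53 := in_refl_sym R35.
have star i : (i < 8)%N -> i != 3%N -> in_refl S (ev i - ev 3).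
  case: i => [|[|[|[|[|[|[|[|i]]]]]]]] i8 i3.
  - exact: (in_refl_diff_trans _ _ _ _ _ _ R01 R13).
  - exact: R13.
  - exact: R23.
  - by case/eqP: i3.
  - exact: (in_refl_diff_trans _ _ _ _ _ _ R45 R53).
  - exact: R53.
  - exact: (in_refl_diff_trans _ _ _ _ _ _ R67 R73).
  - exact: R73.
  - by case: (notF i8).
move=> i j i8 j8 ij.
have [j3|j3] := eqVneq j 3%N; first by rewrite j3 in ij *; apply: star.
have /in_refl_sym R3j := star _ j8 j3.
have [->//|i3] := eqVneq i 3%N.
apply: (in_refl_diff_trans _ _ _ _ _ _ (star _ i8 i3) R3j) => //.
by rewrite eq_sym.
Qed.

Lemma in_refl_ev S : (forall N, S N -> O8D N) ->
  (forall i j, (i < 8)%N -> (j < 8)%N -> i != j -> in_refl S (ev i - ev j)) ->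
  forall n, (n < 8)%N -> in_refl S (ev n) ->
  forall i, (i < 8)%N -> in_refl S (ev i).
Proof.
move=> hS hT n n8 Rn i i8; have [->//|ni] := eqVneq i n.
have := in_refl_act hS (hT i n i8 n8 ni) Rn; rewrite refl_mulmx !dotBl.
rewrite !(dot_evn i8) !(dot_evn n8) !mxE /= !eqxx [n == i]eq_sym (negbTE ni).
have -> : 2 * (0%:R - 1%:R) / (1%:R - 0%:R - (0%:R - 1%:R)) = - 1 :> rat by [].
by rewrite scaleN1r opprK addrC subrK.
Qed.

Definition low4 : 'cV[rat]_8 := mxf 1 (fun i _ => (i < 4)%N%:R).

(** [K12] sends e_0 to half of [low4]. *)
Lemma in_refl_low4 S : (forall N, S N -> O8D N) ->
  generated S K12 -> in_refl S (ev 0) -> in_refl S low4.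
Proof.
move=> hS gK R0; apply: (in_refl_actZ (c := 2^-1) hS gK R0) => //.
rewrite /low4; mxf_compute.
Qed.

(** A sign change is obtained without [CCZ]: split a transposition off [K0123], flip the last sign
    of (1,-1,-1,-1) by a detour through e_4, and apply [K0123], which sends (1,-1,-1,1) to 2 e_3. *)
Lemma in_refl_ev_of_K0123 S : (forall N, S N -> O8D N) ->
  (forall i j, (i < 8)%N -> (j < 8)%N -> i != j -> in_refl S (ev i - ev j)) ->
  generated S K12 -> generated S K0123 -> in_refl S (ev 3).
Proof.
move=> hS hT gK12 gK.
have act g v w : generated S g -> in_refl S v -> g *m v = 1 *: w ->
  in_refl S w by move=> Gg Rv; apply: in_refl_actZ.
(* [K12] sends e_0 - e_3 to e_1 + e_2; two transpositions carry this to e_3 + e_4, whose reflection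
   exchanges e_4 and -e_3. *)
have R12 : in_refl S (ev 1 + ev 2).
  by apply: (act _ _ _ gK12 (hT 0%N 3%N isT isT isT)); mxf_compute.
have R32 : in_refl S (ev 3 + ev 2).
  by apply: (act _ _ _ (hT 1%N 3%N isT isT isT) R12); mxf_compute.
have R34 : in_refl S (ev 3 + ev 4).
  by apply: (act _ _ _ (hT 2%N 4%N isT isT isT) R32); mxf_compute.
(* [K0123] is the product of the reflections in the orthogonal vectors
   [(1,-1,-1,-1)] and [(0,1,-1,0)] that span its -1 eigenspace. *)
have Ru : in_refl S (ev 0 - ev 1 - ev 2 - ev 3).
  rewrite /in_refl; have -> : refl (ev 0 - ev 1 - ev 2 - ev 3) =
    K0123 *m refl (ev 1 - ev 2) by mxf_compute.
  by apply: gen_mul; [exact: gK | exact: hT].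
have Ru' : in_refl S (ev 0 - ev 1 - ev 2 - ev 4).
  by apply: (act _ _ _ (hT 3%N 4%N isT isT isT) Ru); mxf_compute.
have Ru'' : in_refl S (ev 0 - ev 1 - ev 2 + ev 3).
  by apply: (act _ _ _ R34 Ru'); mxf_compute.
apply: (in_refl_actZ (c := 2) hS gK Ru'') => //; mxf_compute.
Qed.

Definition ind (A : {set 'I_8}) : 'cV[rat]_8 := \col_i (i \in A)%:R.

Lemma evE (n : nat) (i : 'I_8) j : ev n i j = (i == n :> nat)%:R.
Proof. by rewrite mxE. Qed.

(** Induction on the number of elements of [A] outside [B] = {0,1,2,3}: a transposition trades one
    of them for an element of [B] missing from [A]. *)
Lemma in_refl_ind S : (forall N, S N -> O8D N) ->
  (forall i j, (i < 8)%N -> (j < 8)%N -> i != j -> in_refl S (ev i - ev j)) ->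
  in_refl S low4 -> forall A : {set 'I_8}, #|A| = 4%N -> in_refl S (ind A).
Proof.
move=> hS hT R4; pose B := [set i : 'I_8 | (i < 4)%N].
have cB : #|B| = 4%N.
  rewrite -sum1dep_card -(big_mkord (fun i => i < 4)%N (fun _ => 1%N)).
  by rewrite unlock.
have IB : ind B = low4 by apply/matrixP => i j; rewrite !mxE inE.
move=> A; have [n] := ubnP #|A :\: B|; elim: n A => [|n IH] A An cA.
  by case: (notF An).
have [AB|/subsetPn[a aA aB]] := boolP (A \subset B).
  have -> : A = B by apply/eqP; rewrite eqEcard AB cA cB.
  by rewrite IB.
have [b bB bA] : exists2 b, b \in B & b \notin A.
  apply/subsetPn; apply: contra aB => BA.
  by have /eqP -> : B == A; first by rewrite eqEcard BA cA cB.
have ab : a != b by apply: contraNneq bA => <-.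
pose A' := b |: A :\ a.
have cA' : #|A'| = 4%N.
  by move: cA; rewrite (cardsD1 a A) aA cardsU1 !inE negb_and bA orbT.
have RA' : in_refl S (ind A').
  apply: (IH _ _ cA'); move: An; rewrite ltnS; apply: leq_trans.
  rewrite (cardsD1 a (A :\: B)) inE aA aB add1n ltnS; apply: subset_leq_card.
  apply/subsetP => i; rewrite !inE => /andP[iB].
  case/orP=> [/eqP ib|/andP[-> ->]]; last by rewrite iB.
  by move: bB; rewrite inE -ib (negbTE iB).
apply: (in_refl_actZ (c := 1) hS (hT a b (ltn_ord a) (ltn_ord b) ab) RA') => //.
rewrite refl_mulmx !dotBl !dot_ev scale1r.
have ba : b == a = false by rewrite eq_sym (negbTE ab).
apply/matrixP => i j; rewrite !mxE !inE /= -!val_eqE /= !eqxx.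
rewrite -[a == b :> nat]/(a == b) -[b == a :> nat]/(b == a) ba (negbTE ab) /=.
rewrite -[i == b :> nat]/(i == b) -[i == a :> nat]/(i == a).
have -> : 2 * (0%:R - 1%:R) / (1%:R - 0%:R - (0%:R - 1%:R)) = - 1 :> rat by [].
have [->|ib] := eqVneq i b; first by rewrite ba (negbTE bA).
by have [->|ia] := eqVneq i a; [rewrite aA | rewrite /= subrr mulr0 subr0].
Qed.

(** * Reduction of an orthogonal matrix column by column *)

Definition reducible S (m : 'I_8) (w : 'cV[rat]_8) : Prop :=
  exists g, [/\ generated S g,
    forall j : 'I_8, (j < m)%N -> g *m ev j = ev j & g *m w = ev m].

Lemma refl_fix (u : 'cV[rat]_8) (j : 'I_8) : u j 0 = 0 -> refl u *m ev j = ev j.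
Proof.
move=> uj; rewrite refl_mulmx.
have -> : dot u (ev j) = dot (ev j) u.
  by rewrite !dotE; apply: eq_bigr => i _; rewrite mulrC.
by rewrite dot_ev uj mulr0 mul0r scale0r subr0.
Qed.

(** The first [m] coordinates of [u] vanish, so its reflection leaves the columns already reduced in
    place. *)
Lemma reducible_refl S (m : 'I_8) (u w : 'cV[rat]_8) : in_refl S u ->
  (forall j : 'I_8, (j < m)%N -> u j 0 = 0) ->
  reducible S m (refl u *m w) -> reducible S m w.
Proof.
move=> Ru u0 [g [Gg gfix gw]]; exists (g *m refl u); split.
- exact: gen_mul.
- by move=> j jm; rewrite -mulmxA refl_fix ?u0 // gfix.
- by rewrite -mulmxA.
Qed.

Lemma int_unit_vector (v : 'cV[int]_8) : \sum_i v i 0 ^+ 2 = 1 ->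
  exists i, (v i 0 = 1 \/ v i 0 = -1) /\ forall j, j != i -> v j 0 = 0.
Proof.
move=> v1; have [i vi] : exists i, v i 0 != 0.
  apply/existsP; apply: contra_eqT v1 => /existsPn v0.
  by rewrite big1 // => i _; have /negPn/eqP -> := v0 i.
exists i; move: v1; rewrite (bigD1 i) //=; set s := \sum_(_ < _ | _) _ => v1.
have s0 : 0 <= s by apply: sumr_ge0 => j _; exact: sqr_ge0.
have {}vi : v i 0 = 1 \/ v i 0 = -1 by nia.
split=> // j ji; have {}s0 : s = 0 by case: vi v1 => -> v1; lia.
have /eqP := s0; rewrite psumr_eq0 => [/allP/(_ j)|k _]; last exact: sqr_ge0.
by rewrite mem_index_enum ji /= sqrf_eq0 => /(_ isT)/eqP.
Qed.

Lemma dot_map_intr (F : fieldType) n (v : 'cV[int]_n) :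
  dot (map_mx intr v) (map_mx intr v) = (\sum_i v i 0 ^+ 2)%:~R :> F.
Proof.
rewrite dotE rmorph_sum; apply: eq_bigr => i _.
by rewrite !mxE rmorphXn expr2.
Qed.

(** Here [w] is some e_i up to sign, with i >= m; a sign change and a transposition take it to
    e_m. *)
Lemma reducible_int S (m : 'I_8) (v : 'cV[int]_8) (w : 'cV[rat]_8) :
  (forall i j, (i < 8)%N -> (j < 8)%N -> i != j -> in_refl S (ev i - ev j)) ->
  (forall i, (i < 8)%N -> in_refl S (ev i)) ->
  w = map_mx intr v -> dot w w = 1 ->
  (forall j : 'I_8, (j < m)%N -> w j 0 = 0) -> reducible S m w.
Proof.
move=> hT hE wv w1 w0.
have [i [vi v0]] : exists i, (v i 0 = 1 \/ v i 0 = -1) /\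
    forall j, j != i -> v j 0 = 0.
  apply: int_unit_vector; apply: (@intr_inj rat).
  by rewrite -dot_map_intr -wv w1.
have wE : w = (v i 0)%:~R *: ev i.
  apply/matrixP => j k; rewrite wv !mxE !ord1 -[j == i :> nat]/(j == i).
  by have [->|/v0->] := eqVneq j i; rewrite ?mulr1 ?mulr0.
have im : (m <= i)%N.
  rewrite leqNgt; apply/negP => /w0; rewrite wv mxE.
  by case: vi => ->.
have e0 n (j : 'I_8) : (m <= n)%N -> (j < m)%N -> ev n j 0 = 0.
  by move=> mn jm; rewrite evE ltn_eqF // (leq_trans jm mn).
have red_i : reducible S m (ev i).
  have [->|mi] := eqVneq i m.
    by exists 1%:M; split=> [|j _|]; rewrite ?mul1mx //; exact: gen_one.
  apply: (reducible_refl (u := ev i - ev m)).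
  - by apply: hT.
  - by move=> j jm; rewrite mxE [X in _ + X]mxE !e0 ?subrr.
  - exists 1%:M; split=> [|j _|]; rewrite ?mul1mx //; first exact: gen_one.
    rewrite refl_mulmx !dotBl !dot_ev !mxE !eqxx eq_sym.
    rewrite -[i == m :> nat]/(i == m) (negbTE mi).
    have -> : 2 * (1%:R - 0%:R) /
      (1%:R - 0%:R - (0%:R - 1%:R)) = 1 :> rat by [].
    by rewrite scale1r opprB addrC subrK.
case: vi wE => -> ->; first by rewrite scale1r.
rewrite scaleN1r; apply: (reducible_refl (hE i (ltn_ord i))) => [j|].
  exact: e0.
rewrite refl_mulmx !dot_ev !mxE eqxx.
have -> : 2 * - 1%:R / 1%:R = - 2 :> rat by [].
by rewrite scaleNr opprK scaler_nat addrC addrK.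
Qed.

(** As |c|^2 = 4, the reflection subtracts (c.v / 2) c from [v], so an even c.v keeps the vector
    integral over the same denominator 2^k. *)
Lemma refl_map_intr (F : numFieldType) n k (w : 'cV[F]_n)
    (v c : 'cV[int]_n) (t : int) :
  2 ^+ k *: w = map_mx intr v -> \sum_i c i 0 ^+ 2 = 4 ->
  \sum_i c i 0 * v i 0 = 2 * t ->
  2 ^+ k *: (refl (map_mx intr c) *m w) = map_mx intr (v - t *: c).
Proof.
move=> wv c4 cv; have k0 : 2 ^+ k != 0 :> F by rewrite expf_neq0 ?pnatr_eq0.
have wE : w = (2 ^+ k)^-1 *: map_mx intr v.
  by rewrite -wv scalerA mulVf // scale1r.
have dcw : dot (map_mx intr c) w = (2 ^+ k)^-1 * (2 * t%:~R).
  have -> : 2 * t%:~R = (2 * t)%:~R :> F by rewrite rmorphM.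
  rewrite -cv rmorph_sum dotE wE mulr_sumr.
  by apply: eq_bigr => i _; rewrite !mxE rmorphM /= mulrCA.
rewrite refl_mulmx dot_map_intr c4 dcw scalerBr wv scalerA.
apply/matrixP => i j; rewrite !mxE rmorphB rmorphM /=.
by congr (_ - _ * _); field.
Qed.

Lemma oddzE (z : int) : ~~ (2 %| z)%Z -> z = 2 * (z %/ 2)%Z + 1.
Proof. lia. Qed.

Lemma sqrz_mod4 (z : int) :
  exists y : int, z ^+ 2 = 4 * y + (~~ (2 %| z)%Z)%:R.
Proof.
have [z2|z2] := boolP (2 %| z)%Z.
  by exists ((z %/ 2)%Z ^+ 2); have : z = 2 * (z %/ 2)%Z; [lia | nia].
by exists ((z %/ 2)%Z ^+ 2 + (z %/ 2)%Z); have := oddzE z2; nia.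
Qed.

Definition odd_entries (v : 'cV[int]_8) : {set 'I_8} :=
  [set i | ~~ (2 %| v i 0%R)%Z].

(** A square is 0 or 1 mod 4 according to parity, so the sum counts the odd entries mod 4. *)
Lemma dvd4_odd_entries (v : 'cV[int]_8) (s : int) :
  \sum_i v i 0 ^+ 2 = 4 * s -> (4 %| #|odd_entries v|)%N.
Proof.
have [y yE] := fin_all_exists (fun i : 'I_8 => sqrz_mod4 (v i 0)).
under eq_bigr do rewrite yE.
rewrite big_split /= -mulr_sumr -natr_sum -big_mkcond /= sum1dep_card.
rewrite -/(odd_entries v) !natz; move: (\sum_i _) #|_| => Y N; lia.
Qed.

(* The sum of the four odd entries is even, and flipping one sign changes it
   by 2 mod 4, so [t] can be made odd; then [v - t c] is even on [A]. *)
Lemma odd_reflection S (v : 'cV[int]_8) (A : {set 'I_8}) :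
  (forall N, S N -> O8D N) -> (forall i, (i < 8)%N -> in_refl S (ev i)) ->
  in_refl S (ind A) -> #|A| = 4%N -> A \subset odd_entries v ->
  exists (c : 'cV[int]_8) (t : int), in_refl S (map_mx intr c) /\
    [/\ forall i, i \notin A -> c i 0 = 0,
        forall i, i \in A -> ~~ (2 %| c i 0%R)%Z,
        \sum_i c i 0 ^+ 2 = 4, \sum_i c i 0 * v i 0 = 2 * t & ~~ (2 %| t)%Z].
Proof.
move=> hS hE RA cA /subsetP Av.
have odA i : i \in A -> ~~ (2 %| v i 0%R)%Z by move/Av; rewrite inE.
have [a aA] : exists a, a \in A by apply/card_gt0P; rewrite cA.
pose c : 'cV[int]_8 := \col_i (i \in A)%:R.
pose d : 'cV[int]_8 := \col_i (if i == a then -1 else (i \in A)%:R).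
(* Each odd entry is 2q + 1; the four remainders add up to 4, which contributes the 2 after
   halving. *)
pose t := \sum_(i in A) (v i 0%R %/ 2)%Z + 2.
have A4 : \sum_(i in A) 1%R = 4%:R :> int by rewrite sumr_const cA.
have c4 : \sum_i c i 0 ^+ 2 = 4.
  rewrite -A4 [RHS]big_mkcond.
  by apply: eq_bigr => i _; rewrite mxE; case: (i \in A).
have d4 : \sum_i d i 0 ^+ 2 = 4.
  rewrite -c4; apply: eq_bigr => i _; rewrite !mxE.
  by have [->|//] := eqVneq i a; rewrite aA.
have ct : \sum_i c i 0 * v i 0 = 2 * t.
  have -> : 2 * t = \sum_(i in A) (2 * (v i 0%R %/ 2)%Z + 1).
    rewrite big_split /= -mulr_sumr mulrDr; congr (_ + _).
    by rewrite A4.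
  rewrite [RHS]big_mkcond; apply: eq_bigr => i _; rewrite mxE.
  case: ifP => iA; last by rewrite mul0r.
  by rewrite mul1r [LHS]oddzE // odA.
have dt : \sum_i d i 0 * v i 0 = 2 * (t - v a 0).
  rewrite mulrBr -ct (bigD1 a) //= [in RHS](bigD1 a) //= !mxE eqxx aA.
  rewrite (eq_bigr (fun i => c i 0 * v i 0)) => [|i /negbTE ia].
    by set s := \sum_(_ < _ | _) _; rewrite mulr1n; ring.
  by rewrite !mxE ia.
have Rc : map_mx intr c = ind A.
  by apply/matrixP => i j; rewrite !mxE; case: (i \in A).
have Rd : map_mx intr d = refl (ev a) *m ind A.
  rewrite refl_mulmx !dot_ev; apply/matrixP => i j; rewrite !mxE eqxx aA.
  rewrite -[i == a :> nat]/(i == a).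
  by have [->|_] := eqVneq i a; [rewrite aA | case: (i \in A)].
have [t2|t2] := boolP (2 %| t)%Z; last first.
  exists c, t; rewrite Rc; split=> //; split=> // i iA.
    by rewrite mxE (negbTE iA).
  by rewrite mxE iA.
exists d, (t - v a 0); rewrite Rd; split.
  exact: (in_refl_act hS (hE a (ltn_ord a)) RA).
split=> //.
- move=> i iA; rewrite mxE (negbTE iA); case: eqP => // ia.
  by rewrite ia aA in iA.
- by move=> i iA; rewrite mxE iA; case: eqP.
- have := odA a aA; lia.
Qed.

Lemma reducible_dyadic S (m : 'I_8) k (v : 'cV[int]_8) (w : 'cV[rat]_8) :
  (forall N, S N -> O8D N) ->
  (forall i j, (i < 8)%N -> (j < 8)%N -> i != j -> in_refl S (ev i - ev j)) ->
  (forall i, (i < 8)%N -> in_refl S (ev i)) -> in_refl S low4 ->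
  2 ^+ k *: w = map_mx intr v -> dot w w = 1 ->
  (forall j : 'I_8, (j < m)%N -> w j 0 = 0) -> reducible S m w.
Proof.
move=> hS hT hE h4.
(* At most 8 entries are odd, so with weight 9 lowering [k] by one outweighs any growth in their
   number. *)
have [n] := ubnP (k * 9 + #|odd_entries v|)%N.
elim: n k v w => [|n IH] k v w hn wv w1 w0; first by case: (notF hn).
case: k hn wv => [|k] hn wv.
  by apply: (reducible_int (v := v)) => //; rewrite -wv expr0 scale1r.
have v2 : \sum_i v i 0 ^+ 2 = 4 * 4 ^+ k.
  apply: (@intr_inj rat); rewrite -dot_map_intr -wv dotZ w1 mulr1.
  by rewrite -exprS rmorphXn /= -exprM mulnC exprM.
have o4 := dvd4_odd_entries v2.
have [o0|o0] := eqVneq #|odd_entries v| 0%N.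
  pose v' : 'cV[int]_8 := \col_i (v i 0%R %/ 2)%Z.
  apply: (IH k v') => //.
    have : (#|odd_entries v'| <= 8)%N.
      by apply: leq_trans (max_card _) _; rewrite card_ord.
    by move: hn; rewrite o0; move: #|_| => x; lia.
  apply/matrixP => i j; have /matrixP/(_ i j) := wv.
  have : i \notin odd_entries v by rewrite (cards0_eq o0) inE.
  rewrite inE negbK !mxE !ord1 => /dvdzP [x xE] /eqP.
  rewrite xE mulzK // rmorphM /= [_ * 2]mulrC exprS -mulrA => /eqP.
  exact: mulfI.
have /card_geqP [s [us ss sv]] : (4 <= #|odd_entries v|)%N.
  by apply: dvdn_leq; rewrite // lt0n.
pose A := [set i in s].
have cA : #|A| = 4%N by rewrite cardsE (card_uniqP us).
have Av : A \subset odd_entries v by apply/subsetP => i; rewrite inE; apply: sv.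
have RA := in_refl_ind hS hT h4 cA.
have [c [t [Rc [c0 c1 c4 ct t1]]]] := odd_reflection hS hE RA cA Av.
(* Below [m] the entries of [v] are 0, hence not odd, so [A] avoids these indices. *)
have u0 (j : 'I_8) : (j < m)%N -> map_mx intr c j 0 = 0 :> rat.
  move=> jm; rewrite mxE c0 //; apply: contraL isT => /(subsetP Av).
  rewrite inE; have /matrixP/(_ j 0) := wv; rewrite !mxE w0 // mulr0.
  by move/eqP; rewrite eq_sym intr_eq0 => /eqP ->.
apply: (reducible_refl Rc u0); apply: (IH k.+1 (v - t *: c)).
(* Parities outside [A] are unchanged, and on [A] odd minus odd times odd is even, so the set of odd
   entries shrinks. *)
- move: hn; rewrite ltnS; apply: leq_trans; rewrite ltn_add2l.
  apply: proper_card; apply/properP; split.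
    apply/subsetP => i; rewrite !inE !mxE.
    have [iA _|/c0 ->] := boolP (i \in A); last by rewrite mulr0 subr0.
    by have := subsetP Av i iA; rewrite inE.
  have [a aA] : exists a, a \in A by apply/card_gt0P; rewrite cA.
  exists a; first exact: (subsetP Av).
  have := subsetP Av a aA; have := c1 a aA; rewrite !inE !mxE negbK.
  move/oddzE => + /oddzE; move: t1 => /oddzE -> -> ->.
  set x := (_ %/ _)%Z; set y := (_ %/ _)%Z; set z := (_ %/ _)%Z.
  by apply/dvdzP; exists (x - 2 * y * z - y - z); ring.
- exact: refl_map_intr.
- by rewrite O8D_dot //; apply: (generated_O8D hS Rc).
- move=> j jm; rewrite refl_mulmx mxE [X in _ + X]mxE [X in - X]mxE u0 //.
  by rewrite mulr0 subr0 w0.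
Qed.

Lemma dyadic_vector (w : 'cV[rat]_8) : (forall i, dyadic (w i 0)) ->
  exists k (v : 'cV[int]_8), 2 ^+ k *: w = map_mx intr v.
Proof.
move=> dw; have [z zE] := fin_all_exists dw.
have [l {}zE] := fin_all_exists zE.
exists (\sum_i l i)%N, (\col_i (z i * 2 ^+ (\sum_i l i - l i)%N)).
apply/matrixP => i j; rewrite !mxE ord1 zE rmorphM rmorphXn /=.
have li : (l i <= \sum_i l i)%N by rewrite (bigD1 i) //= leq_addr.
rewrite -{1}(subnK li) exprD; field.
by rewrite expf_neq0.
Qed.

Lemma generates_of_reflections S : (forall N, S N -> O8D N) ->
  (forall i j, (i < 8)%N -> (j < 8)%N -> i != j -> in_refl S (ev i - ev j)) ->
  (forall i, (i < 8)%N -> in_refl S (ev i)) -> in_refl S low4 -> generates S.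
Proof.
move=> hS hT hE h4 M; split=> [|OM]; first exact: generated_O8D.
(* Then [g *m M] is the identity and [M] is the inverse of [g]. *)
suff [g [Gg gM]] : exists g, generated S g /\
    forall j : 'I_8, (j < 8)%N -> g *m M *m ev j = ev j.
  have gM1 : g *m M = 1%:M.
    apply/matrixP => i j.
    have /matrixP/(_ i 0) := gM j (ltn_ord j).
    rewrite [X in X = _]mxE (bigD1 j) //= !evE eqxx mulr1 big1 ?addr0.
      by move=> ->; rewrite mxE.
    by move=> k kj; rewrite evE -[k == j :> nat]/(k == j) (negbTE kj) mulr0.
  have [ug _] := mulmx1_unit gM1.
  by rewrite -[M](mulKmx ug) gM1 mulmx1; exact: gen_inv.
suff: forall m, (m <= 8)%N -> exists g, generated S g /\
    forall j : 'I_8, (j < m)%N -> g *m M *m ev j = ev j by exact.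
elim=> [|m IH] m8; first by exists 1%:M; split=> //; exact: gen_one.
have [g [Gg gM]] := IH (ltnW m8); pose m' := Ordinal m8.
have ON : O8D (g *m M) by apply: O8D_mul => //; apply: generated_O8D Gg.
pose w := g *m M *m ev m'.
have wE i : w i 0 = (g *m M) i m'.
  rewrite mxE (bigD1 m') //= evE eqxx mulr1 big1 ?addr0 // => k km.
  by rewrite evE -[k == _ :> nat]/(k == m') (negbTE km) mulr0.
have [k [v wv]] : exists k (v : 'cV[int]_8), 2 ^+ k *: w = map_mx intr v.
  by apply: dyadic_vector => i; rewrite wE; case: ON.
have w1 : dot w w = 1 by rewrite O8D_dot // dot_ev evE eqxx.
(* The new column is orthogonal to the earlier ones, which are already the e_j. *)
have w0 (j : 'I_8) : (j < m')%N -> w j 0 = 0.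
  move=> jm; rewrite -dot_ev -(gM j jm) O8D_dot // dot_ev evE.
  by rewrite ltn_eqF.
have [h [Gh hfix hw]] := reducible_dyadic hS hT hE h4 wv w1 w0.
exists (h *m g); split; first exact: gen_mul.
move=> j; rewrite ltnS leq_eqVlt -!mulmxA !(mulmxA g) => /orP[/eqP jm|jm].
  by rewrite jm.
by rewrite gM // hfix.
Qed.

(** * Invariants that obstruct generation *)

(* Involutive generators need no separate closure of [P] under inverses. *)
Lemma generated_ind_involutive (T P : mat8 -> Prop) :
  (forall M, T M -> M *m M = 1%:M) -> P 1%:M ->
  (forall M N, P M -> P N -> P (M *m N)) -> (forall M, T M -> P M) ->
  forall M, generated T M -> P M.
Proof.
move=> TT P1 PM TP M gM.
(* Carrying the claim for the inverse along turns the [gen_inv] case into a swap. *)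
suff: [/\ M \in unitmx, P M & P (invmx M)] by case.
elim: gM => {M} [|M TM|M N _ [uM pM pM'] _ [uN pN pN']|M _ [uM pM pM']].
- by rewrite unitmx1 invmx1.
- have MM := TT M TM; have [uM _] := mulmx1_unit MM.
  have -> : invmx M = M by rewrite -[RHS](mulKmx uM) MM mulmx1.
  by split=> //; apply: TP.
- rewrite unitmx_mul uM uN; split=> //; first exact: PM.
  have -> : invmx (M *m N) = invmx N *m invmx M by exact: invrM.
  exact: PM.
- by rewrite unitmx_inv invmxK.
Qed.

Lemma not_generates (T P : mat8 -> Prop) W :
  (forall M, T M -> M *m M = 1%:M) -> P 1%:M ->
  (forall M N, P M -> P N -> P (M *m N)) -> (forall M, T M -> P M) ->
  O8D W -> ~ P W -> ~ generates T.
Proof.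
move=> TT P1 PM TP OW PW gT; apply: PW.
by apply: (generated_ind_involutive TT P1 PM TP); apply/gT.
Qed.

Lemma not_generates_fixing (v : 'cV[rat]_8) (T : mat8 -> Prop) W :
  (forall M, T M -> M *m M = 1%:M) -> (forall M, T M -> M *m v = v) ->
  O8D W -> W *m v <> v -> ~ generates T.
Proof.
move=> TT Tv; apply: (not_generates (P := fun M => M *m v = v)) => //.
  by rewrite mul1mx.
by move=> M N Mv Nv; rewrite -mulmxA Nv.
Qed.

(** When [A] is the inverse of [B], this says that [M] maps the lattice spanned by the columns of
    [B] into itself. *)
Definition int_conj (A B M : mat8) : Prop :=
  forall i j, (A *m M *m B) i j \is a Num.int.

Lemma not_generates_int_conj (A B : mat8) (T : mat8 -> Prop) W :
  B *m A = 1%:M ->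
  (forall M, T M -> M *m M = 1%:M) -> (forall M, T M -> int_conj A B M) ->
  O8D W -> ~ int_conj A B W -> ~ generates T.
Proof.
move=> BA TT TAB; apply: (not_generates (P := int_conj A B)) => //.
  move=> i j; rewrite mulmx1 (mulmx1C BA) mxE.
  by case: (i == j); rewrite ?rpred0 ?rpred1.
move=> M N iM iN i j.
have -> : A *m (M *m N) *m B = (A *m M *m B) *m (A *m N *m B).
  by rewrite !mulmxA -(mulmxA _ B A) BA mulmx1.
by rewrite mxE; apply: rpred_sum => k _; apply: rpredM.
Qed.

(** * Integrality by computation, and explicit lattice bases *)

Lemma int_mxf f :
  all (fun i => all (fun j => denq (f i j) == 1) (iota 0 8)) (iota 0 8) ->
  forall i j, mxf 8 f i j \is a Num.int.
Proof.
by move=> H i j; rewrite mxE Qint_def; exact: (all_iotaP (all_iotaP H i) j).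
Qed.

Lemma mxf_neq n f g :
  ~~ all (fun i => all (fun j => f i j == g i j) (iota 0 n)) (iota 0 8) ->
  mxf n f <> mxf n g.
Proof.
move=> /negP H E; apply: H; apply/allP => i; rewrite mem_iota => /= i8.
apply/allP => j; rewrite mem_iota => /= jn; apply/eqP.
by have /matrixP/(_ (Ordinal i8) (Ordinal jn)) := E; rewrite !mxE.
Qed.

Lemma not_int_mxf (f : nat -> nat -> rat) (i j : 'I_8) : denq (f i j) != 1 ->
  ~ forall i j, mxf 8 f i j \is a Num.int.
Proof. by move=> /negP H /(_ i j); rewrite mxE Qint_def. Qed.

(* The columns are a basis of [D8+]. *)
Definition D8plus := zmx 2
  [:: [:: 2; 0; 0; 0; 0; 0; 0; 1];
      [:: -2; 2; 0; 0; 0; 0; 0; 1];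
      [:: 0; -2; 2; 0; 0; 0; 0; 1];
      [:: 0; 0; -2; 2; 0; 0; 0; 1];
      [:: 0; 0; 0; -2; 2; 0; 0; 1];
      [:: 0; 0; 0; 0; -2; 2; 2; 1];
      [:: 0; 0; 0; 0; 0; -2; 2; 1];
      [:: 0; 0; 0; 0; 0; 0; 0; 1]].

Definition D8plus_inv := zmx 2
  [:: [:: 2; 0; 0; 0; 0; 0; 0; -2];
      [:: 2; 2; 0; 0; 0; 0; 0; -4];
      [:: 2; 2; 2; 0; 0; 0; 0; -6];
      [:: 2; 2; 2; 2; 0; 0; 0; -8];
      [:: 2; 2; 2; 2; 2; 0; 0; -10];
      [:: 1; 1; 1; 1; 1; 1; -1; -5];
      [:: 1; 1; 1; 1; 1; 1; 1; -7];
      [:: 0; 0; 0; 0; 0; 0; 0; 4]].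

(* The columns are a basis of the vectors reducing mod 2 to [RM(1,3)]. *)
Definition RM13 := zmx 1
  [:: [:: 1; 0; 0; 0; 0; 0; 0; 0];
      [:: 1; 0; 0; 1; 0; 0; 0; 0];
      [:: 1; 0; 1; 0; 0; 0; 0; 0];
      [:: 1; 0; 1; 1; 0; 0; 0; 2];
      [:: 1; 1; 0; 0; 0; 0; 0; 0];
      [:: 1; 1; 0; 1; 0; 0; 2; 0];
      [:: 1; 1; 1; 0; 0; 2; 0; 0];
      [:: 1; 1; 1; 1; 2; 0; 0; 0]].

Definition RM13_inv := zmx 2
  [:: [:: 2; 0; 0; 0; 0; 0; 0; 0];
      [:: -2; 0; 0; 0; 2; 0; 0; 0];
      [:: -2; 0; 2; 0; 0; 0; 0; 0];
      [:: -2; 2; 0; 0; 0; 0; 0; 0];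
      [:: 2; -1; -1; 0; -1; 0; 0; 1];
      [:: 1; 0; -1; 0; -1; 0; 1; 0];
      [:: 1; -1; 0; 0; -1; 1; 0; 0];
      [:: 1; -1; -1; 1; 0; 0; 0; 0]].

(* A quarter turn on the -1 eigenspace of [K0123]. *)
Definition K0123_root := zmx 4
  [:: [:: 3; -1; 3; 1; 0; 0; 0; 0];
      [:: 2; 2; -2; -2; 0; 0; 0; 0];
      [:: 0; 4; 0; 0; 0; 0; 0; 0];
      [:: 1; 1; -3; 3; 0; 0; 0; 0];
      [:: 0; 0; 0; 0; 4; 0; 0; 0];
      [:: 0; 0; 0; 0; 0; 4; 0; 0];
      [:: 0; 0; 0; 0; 0; 0; 4; 0];
      [:: 0; 0; 0; 0; 0; 0; 0; 4]].

Ltac mxf_distinct := mxf_unfold; apply: mxf_neq; by vm_compute.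
Ltac mxf_integral :=
  rewrite /int_conj; mxf_unfold; apply: int_mxf; by vm_compute.
Ltac mxf_not_integral_at i j := rewrite /int_conj; mxf_unfold;
  apply: (not_int_mxf (i := Ordinal (isT : i < 8)%N)
                      (j := Ordinal (isT : j < 8)%N));
  by vm_compute.

(** * The two generating sets and their minimality *)

Lemma Sigma_K_O8D M : Sigma_K M -> O8D M.
Proof.
case=> [->|[->|[->|->]]].
- exact: X0_O8D.
- exact: CX01_O8D.
- exact: CCX12_O8D.
- exact: K0123_O8D.
Qed.

Lemma Sigma_Z_O8D M : Sigma_Z M -> O8D M.
Proof.
case=> [->|[->|[->|[->|->]]]].
- exact: X0_O8D.
- exact: CX01_O8D.
- exact: CCX12_O8D.
- exact: K12_O8D.
- exact: CCZ_O8D.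
Qed.

Lemma Sigma_K_involutive M : Sigma_K M -> M *m M = 1%:M.
Proof. by case=> [->|[->|[->|->]]]; mxf_compute. Qed.

Lemma Sigma_Z_involutive M : Sigma_Z M -> M *m M = 1%:M.
Proof. by case=> [->|[->|[->|[->|->]]]]; mxf_compute. Qed.

Lemma generates_Sigma_Z : generates Sigma_Z.
Proof.
have gX : generated Sigma_Z X0 by apply: gen_base; rewrite /Sigma_Z; tauto.
have gCX : generated Sigma_Z CX01 by apply: gen_base; rewrite /Sigma_Z; tauto.
have gCCX : generated Sigma_Z CCX12 by apply: gen_base; rewrite /Sigma_Z; tauto.
have gK : generated Sigma_Z K12 by apply: gen_base; rewrite /Sigma_Z; tauto.
have hT := in_refl_diff Sigma_Z_O8D gX gCX gCCX gK.
have R7 : in_refl Sigma_Z (ev 7).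
  rewrite /in_refl; have -> : refl (ev 7) = CCZ by mxf_compute.
  by apply: gen_base; rewrite /Sigma_Z; tauto.
have hE := in_refl_ev Sigma_Z_O8D hT (isT : 7 < 8)%N R7.
apply: (generates_of_reflections Sigma_Z_O8D hT hE).
exact: (in_refl_low4 Sigma_Z_O8D gK (hE 0%N isT)).
Qed.

Lemma generates_Sigma_K : generates Sigma_K.
Proof.
have gX : generated Sigma_K X0 by apply: gen_base; rewrite /Sigma_K; tauto.
have gCX : generated Sigma_K CX01 by apply: gen_base; rewrite /Sigma_K; tauto.
have gCCX : generated Sigma_K CCX12 by apply: gen_base; rewrite /Sigma_K; tauto.
have gK : generated Sigma_K K0123 by apply: gen_base; rewrite /Sigma_K; tauto.
have gK12 : generated Sigma_K K12.
  (* Conjugating [K0123] by [X0] moves its action to span(e_4,...,e_7); the two blocks together make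
     [K12]. *)
  have -> : K12 = K0123 *m (X0 *m (K0123 *m X0)) by mxf_compute.
  by do 3![apply: gen_mul; first by []].
have hT := in_refl_diff Sigma_K_O8D gX gCX gCCX gK12.
have R3 := in_refl_ev_of_K0123 Sigma_K_O8D hT gK12 gK.
have hE := in_refl_ev Sigma_K_O8D hT (isT : 3 < 8)%N R3.
apply: (generates_of_reflections Sigma_K_O8D hT hE).
exact: (in_refl_low4 Sigma_K_O8D gK12 (hE 0%N isT)).
Qed.

(** The determinant of [M] is the square of a nonzero number; exhibiting a root spares expanding an
    8 x 8 determinant. *)
Lemma sqr_det_gt0 (M N : mat8) : M *m M = 1%:M -> M = N *m N -> 0 < \det M.
Proof.
move=> MM MN; rewrite MN det_mulmx -expr2 exprn_even_gt0 //=.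
apply: contra_eqN (congr1 determinant MM) => /eqP N0.
by rewrite MN !det_mulmx N0 !mul0r det1 eq_sym oner_eq0.
Qed.

Lemma det_CCZ : \det CCZ = -1.
Proof.
rewrite det_trig; last first.
  by apply/is_trig_mxP => i j ij; rewrite mxE ltn_eqF.
rewrite (bigD1 (Ordinal (isT : 7 < 8)%N)) //= big1 ?mulr1; first by rewrite mxE.
move=> i i7; rewrite mxE eqxx; case: eqP => // i7'.
by case/eqP: i7; apply: val_inj.
Qed.

(** A square root of [X0]: bit 2 is negated at each application, so two applications flip bit 0
    exactly once. [CX01_root] does the same to bit 1 where bit 0 is set. *)
Definition X0_root := perm_mat (fun j =>
  idx (bit0 j (+) bit2 j) (bit1 j) (~~ bit2 j)).

Definition CX01_root := perm_mat (fun j =>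
  idx (bit0 j) (bit1 j (+) (bit0 j && bit2 j)) (bit2 j (+) bit0 j)).

Lemma minimal_Sigma_K T : (forall M, T M -> Sigma_K M) ->
  (exists M, Sigma_K M /\ ~ T M) -> ~ generates T.
Proof.
move=> TS [W [SW TW]].
have TT M : T M -> M *m M = 1%:M by move/TS; apply: Sigma_K_involutive.
have sub M : T M -> M <> W by move=> TM MW; apply: TW; rewrite -MW.
(* [T] misses [W], so a property has to be checked on the other generators only. *)
have cases (P : mat8 -> Prop) : (X0 <> W -> P X0) -> (CX01 <> W -> P CX01) ->
    (CCX12 <> W -> P CCX12) -> (K0123 <> W -> P K0123) -> forall M, T M -> P M.
  move=> P1 P2 P3 P4 M TM; have := sub M TM.
  by case: (TS M TM) => [->|[->|[->|->]]].
case: SW cases => [|[|[|]]] -> cases.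
(* [CX01] swaps e_4 and e_6, while [CCX12] and [K0123] fix both. *)
- apply: (not_generates_fixing (v := vecz [:: 0; 0; 0; 0; 1; 0; 1; 0]) TT
    _ X0_O8D).
    by apply: cases => // _; mxf_compute.
  mxf_distinct.
(* Both halves are (1,0,0,1), which is fixed by [HH]; [CX01] changes the second half to
   (0,1,1,0). *)
- apply: (not_generates_fixing (v := vecz [:: 1; 0; 0; 1; 1; 0; 0; 1]) TT
    _ CX01_O8D).
    by apply: cases => // _; mxf_compute.
  mxf_distinct.
(* The three generators left are squares; [CCZ] is a convenient witness of negative determinant
   because it is diagonal. *)
- apply: (not_generates (P := fun M : mat8 => 0 < \det M) TT _ _ _ CCZ_O8D).
  + by rewrite det1.
  + by move=> M N M0 N0; rewrite det_mulmx mulr_gt0.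
  + apply: cases => // _.
    * by apply: (sqr_det_gt0 (N := X0_root));
        rewrite ?/X0_root; mxf_compute.
    * by apply: (sqr_det_gt0 (N := CX01_root));
        rewrite ?/CX01_root; mxf_compute.
    * by apply: (sqr_det_gt0 (N := K0123_root));
        rewrite ?/K0123_root; mxf_compute.
  + by rewrite det_CCZ.
- apply: (not_generates_int_conj (A := 1%:M) (B := 1%:M) _ TT _ K0123_O8D).
  + by rewrite mulmx1.
  + by apply: cases => // _; mxf_integral.
  + mxf_not_integral_at 0%N 0%N.
Qed.

Lemma minimal_Sigma_Z T : (forall M, T M -> Sigma_Z M) ->
  (exists M, Sigma_Z M /\ ~ T M) -> ~ generates T.
Proof.
move=> TS [W [SW TW]].
have TT M : T M -> M *m M = 1%:M by move/TS; apply: Sigma_Z_involutive.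
have sub M : T M -> M <> W by move=> TM MW; apply: TW; rewrite -MW.
have cases (P : mat8 -> Prop) : (X0 <> W -> P X0) -> (CX01 <> W -> P CX01) ->
    (CCX12 <> W -> P CCX12) -> (K12 <> W -> P K12) -> (CCZ <> W -> P CCZ) ->
    forall M, T M -> P M.
  move=> P1 P2 P3 P4 P5 M TM; have := sub M TM.
  by case: (TS M TM) => [->|[->|[->|[->|->]]]].
case: SW cases => [|[|[|[|]]]] -> cases.
(* (2,1,1,0) is fixed by [HH], and the zeros at indices 3 and 7 make [CCX12] and [CCZ] act
   trivially. *)
- apply: (not_generates_fixing (v := vecz [:: 2; 1; 1; 0; 0; 0; 0; 0]) TT
    _ X0_O8D).
    by apply: cases => // _; mxf_compute.
  mxf_distinct.
- apply: (not_generates_fixing (v := vecz [:: 2; 1; 1; 0; 2; 1; 1; 0]) TT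
    _ CX01_O8D).
    by apply: cases => // _; mxf_compute.
  mxf_distinct.
(* Column 1 of [RM13] is the indicator of x_0; [CCX12] turns it into that of x_0 + x_1 x_2, which is
   quadratic and so outside the code. *)
- apply: (not_generates_int_conj (A := RM13_inv) (B := RM13) _ TT _
    CCX12_O8D); rewrite /RM13 /RM13_inv.
  + mxf_compute.
  + by apply: cases => // _; mxf_integral.
  + mxf_not_integral_at 4%N 1%N.
- apply: (not_generates_int_conj (A := 1%:M) (B := 1%:M) _ TT _ K12_O8D).
  + by rewrite mulmx1.
  + by apply: cases => // _; mxf_integral.
  + mxf_not_integral_at 0%N 0%N.
(* Column 7 of [D8plus] is (1/2,...,1/2); [CCZ] lowers its coordinate sum from 4 to 3, whereas D8+
   has only even sums. *)
- apply: (not_generates_int_conj (A := D8plus_inv) (B := D8plus) _ TT _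
    CCZ_O8D); rewrite /D8plus /D8plus_inv.
  + mxf_compute.
  + by apply: cases => // _; mxf_integral.
  + mxf_not_integral_at 5%N 7%N.
Qed.

Theorem theorem5 :
  minimal_generating_set Sigma_K /\ minimal_generating_set Sigma_Z.
Proof.
split; split.
- exact: generates_Sigma_K.
- exact: minimal_Sigma_K.
- exact: generates_Sigma_Z.
- exact: minimal_Sigma_Z.
Qed.
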